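(* A finite or (right-)infinite word $w$ is rich if and only if each factor of $w$ is uniquely determined by its longest palindromic prefix and its longest palindromic suffix, i.e., whenever $u$ and $v$ are factors of $w$ having the same longest palindromic prefix and the same longest palindromic suffix, then $u = v$.
   Context: For a finite word $w = x_1x_2\cdots x_m$ (letters $x_i$), $|w| = m$ is its length and $\tilde w = x_m\cdots x_2x_1$ its reversal; $w$ is a palindrome if $w = \tilde w$, and the empty word $\varepsilon$ is considered a palindrome. A finite word $z$ is a factor of a finite or infinite word $w$ if $w = uzv$ for some words $u,v$; it is a prefix if $u=\varepsilon$ and a suffix if $v = \varepsilon$. Every finite word has a longest palindromic prefix and a longest palindromic suffix (possibly $\varepsilon$). A finite word $w$ is rich if it has exactly $|w|+1$ distinct palindromic factors (including $\varepsilon$); an infinite word is rich if all of its finite factors are rich. *)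

(* Defs.v *)
From mathcomp Require Import all_boot.
Set Implicit Arguments.
Unset Strict Implicit.
Unset Printing Implicit Defensive.

Section RichWords.
Variable T : eqType.
Implicit Types (s u z : seq T) (x : nat -> T).

Definition palindrome s : bool := s == rev s.

(* The sequence enumerates all factors, possibly with repetitions. *)
Definition factors s : seq (seq T) :=
  [seq take n (drop i s) | i <- iota 0 (size s).+1, n <- iota 0 (size s).+1].

Definition pal_factors s : seq (seq T) :=
  undup [seq z <- factors s | palindrome z].

Definition rich_seq s : Prop := size (pal_factors s) = (size s).+1.

(* The index n = 0 always qualifies, so the maximum is attained. *)
Definition lpp s : seq T :=
  take (\max_(n < (size s).+1 | palindrome (take n s)) n) s.

Definition lps s : seq T :=
  drop (size s - \max_(n < (size s).+1 | palindrome (drop (size s - n) s)) n) s.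

Definition icat s x : nat -> T := fun n => nth (x (n - size s)) s n.

Inductive word := Fin of seq T | Inf of nat -> T.

(* Factors are finite words, also when w is infinite; infix z s means
   s = u ++ z ++ v for some u and v (infixP). *)
Definition factor z (w : word) : Prop :=
  match w with
  | Fin s => infix z s
  | Inf x => exists (u : seq T) (y : nat -> T), x =1 icat u (icat z y)
  end.

Definition rich (w : word) : Prop :=
  match w with
  | Fin s => rich_seq s
  | Inf x => forall z, factor z (Inf x) -> rich_seq z
  end.

Lemma mem_factors z s : (z \in factors s) = infix z s.
Proof.
apply/allpairsP/infixP => [[[i n] /= [_ _ ->]]|[u [v ->]]].
  exists (take i s), (drop n (drop i s)).
  by rewrite cat_take_drop cat_take_drop.
exists (size u, size z); split.
- by rewrite mem_iota add0n ltnS !size_cat /= leq_addr.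
- by rewrite mem_iota add0n ltnS !size_cat /= addnCA leq_addr.
by rewrite drop_size_cat // take_size_cat.
Qed.

Lemma mem_pal_factors z s :
  (z \in pal_factors s) = palindrome z && infix z s.
Proof. by rewrite mem_undup mem_filter mem_factors. Qed.

Lemma lppP s : [/\ prefix (lpp s) s, palindrome (lpp s) &
  forall p, prefix p s -> palindrome p -> size p <= size (lpp s)].
Proof.
have [k Pk Ek] : {k : 'I_(size s).+1 | palindrome (take k s) &
    \max_(n < (size s).+1 | palindrome (take n s)) n = k}.
  by apply: eq_bigmax_cond; apply/card_gt0P; exists ord0;
     rewrite unfold_in /= take0.
rewrite /lpp Ek; split=> //; first by rewrite -[X in prefix _ X](cat_take_drop k s) prefix_prefix.
move=> p; rewrite prefixE => /eqP Ep pp.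
have lp : size p < (size s).+1 by rewrite ltnS -Ep size_take_min geq_minr.
rewrite size_takel -?Ek; last by rewrite Ek -ltnS.
by apply: (@leq_bigmax_cond _ _ (fun n : 'I__ => n : nat) (Ordinal lp)); rewrite /= Ep.
Qed.

Lemma lpsP s : [/\ suffix (lps s) s, palindrome (lps s) &
  forall p, suffix p s -> palindrome p -> size p <= size (lps s)].
Proof.
have [k Pk Ek] : {k : 'I_(size s).+1 | palindrome (drop (size s - k) s) &
    \max_(n < (size s).+1 | palindrome (drop (size s - n) s)) n = k}.
  by apply: eq_bigmax_cond; apply/card_gt0P; exists ord0;
     rewrite unfold_in /= subn0 drop_size.
rewrite /lps Ek; split=> //.
  by apply/suffixP; exists (take (size s - k) s); rewrite cat_take_drop.
move=> p /suffixP[q Eq] pp.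
have lp : size p < (size s).+1 by rewrite ltnS Eq size_cat leq_addl.
rewrite size_drop subKn -?Ek; last by rewrite Ek -ltnS.
apply: (@leq_bigmax_cond _ _ (fun n : 'I__ => n : nat) (Ordinal lp)).
by rewrite /= {1}Eq size_cat addnK Eq drop_size_cat.
Qed.

Lemma factor_InfP z x :
  factor z (Inf x) <-> exists i, z = mkseq (fun j => x (i + j)) (size z).
Proof.
split=> [[u [y E]]|[i E]].
  case: z E => [|a z] E; first by exists 0.
  exists (size u); apply: (@eq_from_nth _ a) => [|j lj]; first by rewrite size_mkseq.
  rewrite nth_mkseq // E /icat [RHS]nth_default ?leq_addr // addKn.
  exact: set_nth_default.
exists (mkseq x i), (fun n => x (i + (size z + n))) => n.
rewrite /icat size_mkseq; have [lt|le] := ltnP n i; first by rewrite nth_mkseq.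
rewrite nth_default ?size_mkseq //.
have [lt|le'] := ltnP (n - i) (size z).
  by rewrite [in RHS]E nth_mkseq // subnKC.
by rewrite nth_default // !subnKC.
Qed.

End RichWords.

(* Main.v *)
Require Import Defs.
From mathcomp Require Import all_boot.

(** Appending a letter to a finite word creates at most one new palindromic
    factor, namely the longest palindromic suffix; hence a word is rich iff
    that suffix is new at every prefix, and in a rich word the longest
    palindromic prefix and suffix of any factor occur in it only once.

    If [w] is rich, we show by induction on a factor [z] of [w] containing [u]
    and [v] that the unordered pair of longest palindromic prefix and suffix
    determines [u] up to reversal.  When [v] is a suffix of [z], the longest
    palindromic suffix of [z] is either that of [v], which by uniqueness forces
    [u] to be a suffix of [z] as well, or it is longer than [v], and then
    [rev v] occurs in [z] without its last letter.

    Conversely, if the longest palindromic suffix [q] of some factor recurs in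
    it, then a shortest suffix starting with a non-final occurrence of [q] has
    [q] both as longest palindromic prefix and suffix, and so has [q]. *)

Set Implicit Arguments.
Unset Strict Implicit.
Unset Printing Implicit Defensive.

Section RichSeq.
Variable T : eqType.
Implicit Types (s u v z p q t : seq T) (x : nat -> T).

(** * Longest palindromic prefixes and suffixes under reversal *)

Lemma palindromeP s : reflect (rev s = s) (palindrome s).
Proof. by rewrite /palindrome eq_sym; apply: eqP. Qed.

Lemma suffix_size_eq u v s :
  suffix u s -> suffix v s -> size u = size v -> u = v.
Proof. by rewrite !suffixE => /eqP Eu /eqP Ev E; rewrite E in Eu; rewrite -Eu. Qed.

Lemma suffix_comparable u v s :
  suffix u s -> suffix v s -> size u <= size v -> suffix u v.
Proof.
move=> su sv le; have lv := size_suffix sv.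
move: su sv; rewrite !suffixE => /eqP Eu /eqP Ev.
by rewrite -[in X in drop _ X]Ev drop_drop addnC addnBA // subnK // Eu.
Qed.

Lemma lps_eqP s p : suffix p s -> palindrome p ->
  (forall q, suffix q s -> palindrome q -> size q <= size p) -> lps s = p.
Proof.
move=> sp pp maxp; have [sl pl maxl] := lpsP s.
apply: (suffix_size_eq sl sp); apply/eqP.
by rewrite eqn_leq (maxp _ sl pl) (maxl _ sp pp).
Qed.

Lemma lps_rev s : lps (rev s) = lpp s.
Proof.
have [sl pl maxl] := lppP s; apply: lps_eqP => // [|q sq pq].
  by rewrite -[lpp s](palindromeP _ pl) suffix_rev.
by apply: maxl => //; rewrite -suffix_rev (palindromeP _ pq).
Qed.

Lemma lpp_rev s : lpp (rev s) = lps s.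
Proof. by rewrite -lps_rev revK. Qed.

Lemma lps_palindrome s : palindrome s -> lps s = s.
Proof.
by move=> ps; apply: lps_eqP (suffix_refl _) ps _ => q /size_suffix.
Qed.

Lemma lpp_palindrome s : palindrome s -> lpp s = s.
Proof. by move=> ps; rewrite -lps_rev (palindromeP _ ps) lps_palindrome. Qed.

Lemma lps_suffix s t : suffix t s -> size (lps s) <= size t -> lps t = lps s.
Proof.
have [sl pl maxl] := lpsP s => st le.
apply: lps_eqP => // [|q sq]; first exact: suffix_comparable sl st le.
exact/maxl/(suffix_trans sq).
Qed.

(** * Counting palindromic factors letter by letter *)

Lemma pal_factors_rcons s a :
  size (pal_factors (rcons s a)) =
  ~~ infix (lps (rcons s a)) s + size (pal_factors s).
Proof.
have [sl pl maxl] := lpsP (rcons s a).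
set l := lps _ in sl pl maxl *.
pose r := if infix l s then pal_factors s else l :: pal_factors s.
have -> : ~~ infix l s + size (pal_factors s) = size r by rewrite /r; case: ifP.
apply/perm_size/uniq_perm; first exact: undup_uniq.
  rewrite /r; case: ifP => [_|/= nl]; first exact: undup_uniq.
  by rewrite mem_pal_factors nl andbF undup_uniq.
move=> z; rewrite mem_pal_factors infix_rconsl orbC.
have -> : (z \in r) = (z == l) || palindrome z && infix z s.
  rewrite /r; case: ifP => il; last by rewrite inE mem_pal_factors.
  by rewrite mem_pal_factors; case: eqP => // ->; rewrite pl il.
have [->|nzl] /= := eqVneq z l; first by rewrite pl sl orbT.
have [pz|//] /= := boolP (palindrome z).
apply/orP/idP => [[//|sz]|->]; last by left.
(* A palindromic suffix [z] other than [l] is also a prefix of the palindrome [l], so it occurs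
   before the last letter, inside [s]. *)
have szl := suffix_comparable sz sl (maxl _ sz pz).
have /prefixP[b El] : prefix z l.
  by rewrite -[z](palindromeP _ pz) -[l](palindromeP _ pl) prefix_rev.
case/lastP: b El => [|b c] El; first by rewrite El cats0 eqxx in nzl.
case/suffixP: sl => d; rewrite El -!rcons_cat => /rcons_inj[-> _].
by apply/infixP; exists d, b.
Qed.

Lemma leq_pal_factors s : size (pal_factors s) <= (size s).+1.
Proof.
elim/last_ind: s => [|s a IH]; first by [].
rewrite pal_factors_rcons size_rcons.
by case: infix; rewrite ?add0n ?add1n ?ltnS // (leq_trans IH).
Qed.

Lemma rich_seq_rcons s a :
  rich_seq (rcons s a) <-> rich_seq s /\ ~~ infix (lps (rcons s a)) s.
Proof.
rewrite /rich_seq pal_factors_rcons size_rcons; have := leq_pal_factors s.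
case: infix => /= le; last by rewrite add1n; split=> [[]|[->]].
by split=> [E|[]//]; rewrite add0n in E; rewrite E ltnn in le.
Qed.

Lemma rich_seq_rev s : rich_seq (rev s) <-> rich_seq s.
Proof.
rewrite /rich_seq size_rev.
suff -> : size (pal_factors (rev s)) = size (pal_factors s) by [].
apply/perm_size/uniq_perm; rewrite ?undup_uniq // => z.
rewrite !mem_pal_factors; have [pz|//] /= := boolP (palindrome z).
by rewrite -{1}[z](palindromeP _ pz) infix_rev.
Qed.

Lemma rich_seq_catl s t : rich_seq (s ++ t) -> rich_seq s.
Proof.
elim/last_ind: t => [|t a IH]; first by rewrite cats0.
by rewrite -rcons_cat => /rich_seq_rcons[/IH].
Qed.

Lemma rich_seq_catr s t : rich_seq (s ++ t) -> rich_seq t.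
Proof. by move/rich_seq_rev; rewrite rev_cat => /rich_seq_catl/rich_seq_rev. Qed.

Lemma rich_seq_infix s t : infix s t -> rich_seq t -> rich_seq s.
Proof. by move=> /infixP[a [b ->]] /rich_seq_catr/rich_seq_catl. Qed.

(** * Unique occurrence of the end palindromes in a rich word *)

Lemma rich_lps_last s a b : rich_seq s -> s = a ++ lps s ++ b -> b = [::].
Proof.
case/lastP: b => // b c rs E; move: rs; rewrite E -!rcons_cat.
case/rich_seq_rcons=> _ /negP[]; rewrite !rcons_cat -E.
exact: infix_infix.
Qed.

Lemma rich_lpp_first s a b : rich_seq s -> s = a ++ lpp s ++ b -> a = [::].
Proof.
move=> rs E; apply: (can_inj revK).
apply: (@rich_lps_last (rev s) (rev b)); first exact/rich_seq_rev.
have [_ pl _] := lppP s.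
by rewrite lps_rev {1}E !rev_cat (palindromeP _ pl) catA.
Qed.

Lemma lpp_infix s : infix (lpp s) s.
Proof. by have [/prefixW] := lppP s. Qed.

Lemma lps_infix s : infix (lps s) s.
Proof. by have [/suffixW] := lpsP s. Qed.

(** The occurrence of [lpp v] inside [u] must be the one at the start of [v], so [u] starts there
    too. *)
Lemma rich_lpp_suffix u v :
  rich_seq v -> suffix u v -> infix (lpp v) u -> u = v.
Proof.
move=> rv /suffixP[a E] /infixP[b [c Eu]].
have : a ++ b = [::].
  by apply: (@rich_lpp_first v _ c) => //; rewrite {1}E Eu catA.
by rewrite E; case: a {E}.
Qed.

(** The pair is unordered so that either word may be replaced by its reversal in the induction. *)
Definition same_ends u v :=
  (lpp u = lpp v /\ lps u = lps v) \/ (lpp u = lps v /\ lps u = lpp v).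

Lemma same_ends_sym u v : same_ends u v -> same_ends v u.
Proof. by rewrite /same_ends => -[] [-> ->]; [left|right]. Qed.

Lemma same_ends_revr u v : same_ends u v -> same_ends u (rev v).
Proof. by rewrite /same_ends lps_rev lpp_rev => -[]; [right|left]. Qed.

Lemma same_ends_infix u v :
  same_ends u v -> infix (lpp v) u /\ infix (lps v) u.
Proof. by case=> -[<- <-]; split; rewrite ?lpp_infix ?lps_infix. Qed.

Lemma rich_same_ends_suffix z u v :
  rich_seq z -> suffix u z -> suffix v z -> same_ends u v -> u = v.
Proof.
wlog le : u v / size u <= size v.
  move=> H; case/orP: (leq_total (size u) (size v)) => le; first exact: H.
  by move=> rz su sv /same_ends_sym e; apply/esym/H.
move=> rz su sv /same_ends_infix[iv _].
apply: rich_lpp_suffix iv; first exact: rich_seq_infix (suffixW sv) rz.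
exact: suffix_comparable su sv le.
Qed.

Lemma rich_same_ends z u v :
  rich_seq z -> infix u z -> infix v z -> same_ends u v -> v = u \/ v = rev u.
Proof.
elim/last_ind: z u v => [|z a IH] u v rza.
  by rewrite !infixs0 => /eqP-> /eqP->; left.
have rz : rich_seq z by case/rich_seq_rcons: rza.
wlog sv : u v / suffix v (rcons z a).
  move=> H iu iv e; move: (iu) (iv); rewrite !infix_rconsl ![suffix _ _ || _]orbC.
  case/orP=> [iu'|su]; last first.
    by move=> _; case: (H v u su iv iu (same_ends_sym e)) => ->; rewrite ?revK; auto.
  by case/orP=> [iv'|sv]; [apply: IH | apply: H].
move=> iu _ e; have suE su := esym (rich_same_ends_suffix rza su sv e).
have [le|lt] := leqP (size (lps (rcons z a))) (size v).
  left; apply: suE; have [_] := same_ends_infix e.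
  rewrite (lps_suffix sv le) => /infixP[c [d Eu]].
  case/infixP: iu => b [f Ez].
  (* This occurrence lies inside that of [u]; since it is the final one, nothing follows [u]. *)
  have /(rich_lps_last rza) : rcons z a = (b ++ c) ++ lps (rcons z a) ++ (d ++ f).
    by rewrite {1}Ez Eu -!catA.
  move/(congr1 size)/eqP; rewrite Ez size_cat addn_eq0 => /andP[_ /nilP->].
  by rewrite cats0 suffix_suffix.
move: iu; rewrite infix_rconsl => /orP[/suE|iu]; first by left.
have irv : infix (rev v) z.
  have [sl pl _] := lpsP (rcons z a).
  have svl := suffix_comparable sv sl (ltnW lt).
  move: svl; rewrite -prefix_rev (palindromeP _ pl) => /prefixP[b El].
  case/lastP: b El lt => [|b c] El; first by rewrite El cats0 size_rev ltnn.
  move=> _; case/suffixP: sl => d; rewrite El -!rcons_cat => /rcons_inj[-> _].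
  exact: infix_infix.
case: (IH u (rev v) rz iu irv (same_ends_revr e)) => [<-|/(can_inj revK)->].
  by right; rewrite revK.
by left.
Qed.

Definition determined_by_ends (P : seq T -> Prop) :=
  forall u v, P u -> P v -> lpp u = lpp v -> lps u = lps v -> u = v.

Lemma rich_determined z :
  rich_seq z -> determined_by_ends (fun u => infix u z).
Proof.
move=> rz u v iu iv ep es.
case: (rich_same_ends rz iu iv (or_introl (conj ep es))) => // ev.
(* In the case [v = rev u] both end palindromes of [u] coincide; by unique occurrence they are all
   of [u], which is thus a palindrome. *)
have eu : lpp u = lps u by rewrite es ev lps_rev.
have [sl pl _] := lpsP u.
have lu : lps u = u.
  by apply: rich_lpp_suffix sl _; rewrite ?eu ?infix_refl //; apply: rich_seq_infix rz.
by rewrite ev -lu (palindromeP _ pl).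
Qed.

(** * Recurrence of the longest palindromic suffix *)

Lemma lps_return t q : lps t = q -> prefix q t -> size q < size t ->
  exists2 t', suffix t' t & [/\ lpp t' = q, lps t' = q & t' != q].
Proof.
have [n] := ubnP (size t); elim: n t => // n IH t; rewrite ltnS => len Eq pq lt.
have [pl ppl maxl] := lppP t; have [_ pals _] := lpsP t; rewrite Eq in pals.
have := maxl _ pq pals; rewrite leq_eqVlt => /orP[/eqP es|ltq].
  exists t; first exact: suffix_refl.
  split=> //; last by apply: contraTneq lt => ->; rewrite ltnn.
  by move: pl pq; rewrite !prefixE es => /eqP El /eqP; rewrite El.
have Nt : lpp t != t.
  by apply: contraTneq lt => Et; rewrite -Eq lps_palindrome ?ltnn // -Et.
have /prefixP[b Et] := pl.
(* As [q] and [lpp t] are palindromic prefixes of [t], [q] also ends [lpp t]. This later occurrence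
   is not final, and the suffix [q ++ b] starting there is shorter than [t]. *)
have /suffixP[c El] : suffix q (lpp t).
  rewrite -[q](palindromeP _ pals) -[lpp t](palindromeP _ ppl).
  by apply: (@suffix_comparable _ _ (rev t)); rewrite ?suffix_rev ?size_rev // ltnW.
have b0 : 0 < size b.
  by rewrite lt0n; apply: contraNneq Nt => /size0nil b0; rewrite {2}Et b0 cats0.
have c0 : 0 < size c by move: ltq; rewrite El size_cat -{1}[size q]add0n ltn_add2r.
have Et' : t = c ++ (q ++ b) by rewrite {1}Et El catA.
have st : suffix (q ++ b) t by rewrite Et' suffix_suffix.
have [||||t' st' Ht'] := IH (q ++ b).
- apply: leq_trans len; rewrite Et' [size (c ++ _)]size_cat.
  by rewrite -{1}[size (q ++ b)]add0n ltn_add2r.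
- by rewrite -Eq; apply: lps_suffix; rewrite ?Eq // size_cat leq_addr.
- exact: prefix_prefix.
- by rewrite size_cat -{1}[size q]addn0 ltn_add2l.
by exists t' => //; apply: suffix_trans st' st.
Qed.

Lemma determined_rich z :
  determined_by_ends (fun u => infix u z) -> rich_seq z.
Proof.
elim/last_ind: z => [//|z a IH] H; apply/rich_seq_rcons; split.
  by apply: IH => u v iu iv; apply: H; rewrite infix_rconsl ?iu ?iv orbT.
apply/negP=> /infixP[b [c Ez]]; set q := lps _ in Ez.
have [_ pq _] := lpsP (rcons z a); rewrite -/q in pq.
have Et : rcons z a = b ++ (q ++ rcons c a) by rewrite Ez -!rcons_cat.
have st : suffix (q ++ rcons c a) (rcons z a) by rewrite Et suffix_suffix.
have [|||t' st' [ep es /eqP[]]] := @lps_return (q ++ rcons c a) q.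
- by apply: lps_suffix; rewrite // -/q size_cat leq_addr.
- exact: prefix_prefix.
- by rewrite size_cat size_rcons addnS ltnS leq_addr.
apply: H; rewrite ?lps_infix ?ep ?es ?lps_palindrome ?lpp_palindrome //.
exact/suffixW/(suffix_trans st').
Qed.

(** * Factors of infinite words *)

Lemma icat_cat s t x : icat (s ++ t) x =1 icat s (icat t x).
Proof.
move=> n; rewrite /icat nth_cat size_cat subnDA.
by case: ltnP => le; [apply: set_nth_default | rewrite [RHS]nth_default].
Qed.

Lemma eq_icat s x y : x =1 y -> icat s x =1 icat s y.
Proof. by move=> E n; rewrite /icat E. Qed.

Lemma factor_Inf_infix u z x :
  infix u z -> factor z (Inf x) -> factor u (Inf x).
Proof.
move=> /infixP[a [b ->]] [c [y E]]; exists (c ++ a), (icat b y) => n.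
rewrite E icat_cat; apply: eq_icat => m.
by rewrite icat_cat; apply: eq_icat => k; rewrite icat_cat.
Qed.

Lemma infix_mkseq x i m n : i + m <= n ->
  infix (mkseq (fun j => x (i + j)) m) (mkseq x n).
Proof.
move=> le; apply/infixP.
exists (mkseq x i), (mkseq (fun j => x (i + m + j)) (n - (i + m))).
rewrite /mkseq -{1}(subnKC le) !iotaD !map_cat -catA add0n.
by rewrite -{2}[i]addn0 -[X in iota X (n - _)]addn0 !iotaDl -!map_comp.
Qed.

End RichSeq.

Theorem theorem1p6 (T : eqType) (w : word T) :
  rich w <->
  (forall u v : seq T, factor u w -> factor v w ->
     lpp u = lpp v -> lps u = lps v -> u = v).
Proof.
case: w => [s|x] /=.
  by split=> [/rich_determined|/determined_rich].
split=> [rx u v /factor_InfP[i Eu] /factor_InfP[j Ev]|H z fz].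
  (* A prefix of [x] long enough to contain both occurrences reduces to the finite case. *)
  pose n := maxn (i + size u) (j + size v).
  apply: (@rich_determined _ (mkseq x n)).
  - by apply/rx/factor_InfP; exists 0; rewrite size_mkseq.
  - by rewrite Eu infix_mkseq // leq_maxl.
  - by rewrite Ev infix_mkseq // leq_maxr.
apply: determined_rich => u v iu iv.
by apply: H; [apply: factor_Inf_infix iu fz | apply: factor_Inf_infix iv fz].
Qed.
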